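(* Let $\mathbf{s}=(s_1,\ldots,s_r)$ be integers greater than $1$, $G=\mathbb{Z}_{s_1}\times\cdots\times\mathbb{Z}_{s_r}$, $\mathbf{z}\in\{0,1\}^r$ with $\mathbf{z}\neq\mathbf{0}$, and let $\phi:G\to\{\pm1\}$ with $\phi(0)=1$. Let $\psi=f_{\mathbf z}\,\partial\phi$ and let $\Gamma:E_\psi\to E/K$ be the map $\Gamma(u,x)=\iota(u\phi(x))+\tau(x)$ (notation in the context). Then $\Gamma$ maps $\{(1,x)\mid x\in G\}\subseteq E_\psi$ onto $\{g+K\in E/K\mid \phi'(g)=1\}$.
   Context: Cyclic groups are written additively. $E=\mathbb{Z}_{(z_1+1)s_1}\times\cdots\times\mathbb{Z}_{(z_r+1)s_r}$, $H=\{h\in E : h_i=0 \text{ if } z_i=0,\ h_i\in\{0,s_i\}\text{ if } z_i=1\}$, $K=\{k\in H: k\text{ has an even number of nonzero coordinates}\}$; since $\mathbf z\ne\mathbf 0$, $H/K$ has order 2. Let $\iota:\{\pm1\}\to E/K$ be the injective homomorphism sending $-1$ to the generator of $H/K$. Identify $x\in G$ with the element of $E$ having coordinates $x_i\in\{0,\ldots,s_i-1\}$, and set $\tau(x)=x+K$. Define $f_{\mathbf z}(x,y)=\iota^{-1}(\tau(x)+\tau(y)-\tau(x+y))\in\{\pm1\}$ for $x,y\in G$ (a cocycle). For $\phi:G\to\{\pm1\}$, $\partial\phi(x,y)=\phi(x)\phi(y)\phi(x+y)$. For a cocycle $\psi:G\times G\to\{\pm1\}$, $E_\psi$ is the group on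 $\{\pm1\}\times G$ with $(u,x)(v,y)=(uv\,\psi(x,y),x+y)$. For $g\in E$ with reduction $a$ modulo $\mathbf s$ (coordinatewise), the expansion is $\phi'(g)=\phi(a)$ if $g\in a+K$ and $-\phi(a)$ otherwise. *)

(* Defs.v *)
From HB Require Import structures.
From mathcomp Require Import all_boot all_order all_algebra all_fingroup all_solvable.
Set Implicit Arguments.
Unset Strict Implicit.
Unset Printing Implicit Defensive.
Import GRing.Theory.
Local Open Scope group_scope.

Definition pm1 : predArgType := seq_sub [:: 1; -1 : int]%R.
HB.instance Definition _ := Finite.on pm1.

Fact pm1_1_subproof : 1%R \in [:: 1; -1 : int]%R. Proof. by []. Qed.

Fact pm1_M_subproof (u v : pm1) : (ssval u * ssval v)%R \in [:: 1; -1 : int]%R.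
Proof.
by case: u v => [u /= + [v /=]]; rewrite !inE => /orP[]/eqP-> /orP[]/eqP->.
Qed.

Fact pm1_N_subproof (u : pm1) : (- ssval u)%R \in [:: 1; -1 : int]%R.
Proof. by case: u => [u /=]; rewrite !inE => /orP[]/eqP->. Qed.

Definition pm1_one : pm1 := SeqSub pm1_1_subproof.
Definition pm1_mul (u v : pm1) : pm1 := SeqSub (pm1_M_subproof u v).
Definition pm1_opp (u : pm1) : pm1 := SeqSub (pm1_N_subproof u).

Fact pm1_mulA : associative pm1_mul.
Proof. by move=> u v w; apply: val_inj; rewrite /= mulrA. Qed.

Fact pm1_mul1 : left_id pm1_one pm1_mul.
Proof. by move=> u; apply: val_inj; rewrite /= mul1r. Qed.

Fact pm1_mulV : left_inverse pm1_one id pm1_mul.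
Proof.
move=> [u uP]; apply: val_inj => /=.
by move: uP; rewrite !inE => /orP[]/eqP->.
Qed.

HB.instance Definition _ := Finite_isGroup.Build pm1 pm1_mulA pm1_mul1 pm1_mulV.

Lemma pm1_cases (u : pm1) : u = 1 \/ u = pm1_opp 1.
Proof.
case: u => u uP; have := uP; rewrite !inE => /orP[]/eqP uE; [left|right];
exact: val_inj.
Qed.

Lemma pm1_mulC (u v : pm1) : u * v = v * u.
Proof. by apply: val_inj; rewrite /= mulrC. Qed.

Lemma pm1_sqr (u : pm1) : u * u = 1. Proof. exact: pm1_mulV. Qed.

Definition is_cocycle (gT : finGroupType) (psi : gT -> gT -> pm1) : Prop :=
  forall x y t, psi x y * psi (x * y) t = psi x (y * t) * psi y t.

Lemma is_cocycleM (gT : finGroupType) (psi1 psi2 : gT -> gT -> pm1) :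
  is_cocycle psi1 -> is_cocycle psi2 ->
  is_cocycle (fun x y => psi1 x y * psi2 x y).
Proof.
have ACA (a b c d : pm1) : a * b * (c * d) = a * c * (b * d).
  by rewrite -!mulgA; congr (_ * _); rewrite !mulgA (pm1_mulC b).
by move=> c1 c2 x y t; rewrite ACA c1 c2 ACA.
Qed.

Definition cobound (gT : finGroupType) (phi : gT -> pm1) (x y : gT) : pm1 :=
  phi x * phi y * phi (x * y).

Lemma cobound_cocycle (gT : finGroupType) (phi : gT -> pm1) :
  is_cocycle (cobound phi).
Proof.
move=> x y t; rewrite /cobound -!mulgA.
move: (phi x) (phi y) (phi t) (phi (x * y)) (phi (y * t)) (phi (x * (y * t))).
move=> a b c d e g.
do [case: (pm1_cases a) => ->]; do [case: (pm1_cases b) => ->];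
do [case: (pm1_cases c) => ->]; do [case: (pm1_cases d) => ->];
do [case: (pm1_cases e) => ->]; do [case: (pm1_cases g) => ->];
exact: val_inj.
Qed.

Record cocycle (gT : finGroupType) := Cocycle {
  cocycle_fun :> gT -> gT -> pm1;
  cocycleP : is_cocycle cocycle_fun
}.

Definition cext (gT : finGroupType) (psi : cocycle gT) : Type := (pm1 * gT)%type.
HB.instance Definition _ gT (psi : cocycle gT) := Finite.on (cext psi).

Section CentralExtension.
Variables (gT : finGroupType) (psi : cocycle gT).

Definition cext_mul (a b : cext psi) : cext psi :=
  (a.1 * b.1 * psi a.2 b.2, a.2 * b.2).
(* Cocycles are not assumed normalized, so the unit is (psi 1 1, 1).           *)
Definition cext_one : cext psi := (psi 1 1, 1).
Definition cext_inv (a : cext psi) : cext psi :=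
  (a.1 * psi a.2^-1 a.2 * psi 1 1, a.2^-1).

Fact cext_mulA : associative cext_mul.
Proof.
move=> [u x] [v y] [w t]; congr pair => /=; last exact: mulgA.
rewrite -!mulgA; do 2!congr (_ * _).
by rewrite (mulgA _ w) (pm1_mulC _ w) -!mulgA (cocycleP psi) (pm1_mulC (psi y t)).
Qed.

Fact cext_mul1 : left_id cext_one cext_mul.
Proof.
move=> [u x]; congr pair => /=; last exact: mul1g.
have := cocycleP psi 1 1 x; rewrite !mul1g => /mulIg ->.
by rewrite (pm1_mulC _ u) -mulgA pm1_sqr mulg1.
Qed.

Fact cext_mulV : left_inverse cext_one cext_inv cext_mul.
Proof.
move=> [u x]; congr pair => /=; last exact: mulVg.
rewrite -!mulgA (pm1_mulC u) -!mulgA (pm1_mulC u) -!mulgA pm1_sqr mulg1.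
by rewrite pm1_mulC -mulgA pm1_sqr mulg1.
Qed.

HB.instance Definition _ :=
  Finite_isGroup.Build (cext psi) cext_mulA cext_mul1 cext_mulV.
End CentralExtension.

(* The finGroupType law of 'Z_n is addition mod n, which group_scope writes    *)
(* multiplicatively, here as well as in products and quotients of such groups. *)
(* Beware that 'Z_n is the integers mod n only for n > 1.                      *)
Notation zprod m := {dffun forall i, 'Z_(m i)}.

Notation zprodE s z := (zprod (fun i => (z i + 1) * s i)%N).

Section Expansion.
Variables (r : nat) (s : 'I_r -> nat) (z : 'I_r -> bool).

Local Notation G := (zprod s).
Local Notation E := (zprodE s z).

Definition Hset : {set E} :=
  [set h : E | [forall i, if z i then (h i == 0%R) || (h i == (s i)%:R%R)
                          else h i == 0%R]].

Definition Kset : {set E} :=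
  [set k in Hset | ~~ odd #|[set i | k i != 0%R]|].

Lemma in_Kset (k : E) :
  (k \in Kset) = (k \in Hset) && ~~ odd #|[set i | k i != 0%R]|.
Proof. by rewrite inE. Qed.

Lemma cyc_double i : z i ->
  ((s i)%:R + (s i)%:R = 0 :> 'Z_((z i + 1) * s i))%R.
Proof.
move=> ->; rewrite -natrD addnn -mul2n addn1.
case: (s i) => [|n]; first by rewrite muln0.
by rewrite pchar_Zp // mul2n doubleS.
Qed.

Lemma HsetP (h : E) : reflect
  (forall i, h i = 0%R \/ z i /\ h i = (s i)%:R%R) (h \in Hset).
Proof.
have ifE (b p q : bool) : (if b then p || q else p) = p || b && q.
  by case: b; rewrite ?orbF.
rewrite inE; apply: (iffP forallP) => H i; have := H i; rewrite ifE.
  by case/orP=> [/eqP-> | /andP[zi /eqP->]]; [left | right].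
case=> [-> | [zi ->]]; first by rewrite eqxx.
by apply/orP; right; apply/andP; split.
Qed.

Lemma Hset_sum (h k : E) i : h \in Hset -> k \in Hset ->
  ((h * k) i != 0%R) = (h i != 0%R) (+) (k i != 0%R).
Proof.
move=> /HsetP/(_ i) Hh /HsetP/(_ i) Hk; rewrite ffunE /=.
rewrite -[(h i * k i)]/((h i + k i)%R).
case: Hh => [->|[zi ->]]; first by rewrite add0r eqxx.
case: Hk => [->|[_ ->]]; first by rewrite addr0 eqxx addbF.
by rewrite cyc_double // eqxx addbb.
Qed.

Lemma Hset_group_set : group_set Hset.
Proof.
apply/group_setP; split=> [|h k /HsetP Hh /HsetP Hk].
  by apply/HsetP => i; left; rewrite ffunE.
apply/HsetP => i; rewrite ffunE /= -[(h i * k i)]/((h i + k i)%R).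
case: (Hh i) => [->|[zi ->]]; first by rewrite add0r; exact: Hk.
case: (Hk i) => [->|[_ ->]]; first by rewrite addr0; right.
by rewrite cyc_double //; left.
Qed.
Canonical Hgroup := Group Hset_group_set.

Lemma odd_card_set (P : pred 'I_r) :
  odd #|[set i | P i]| = \big[addb/false]_i P i.
Proof.
rewrite -sum1_card big_mkcond /= (big_morph odd oddD erefl).
by apply: eq_bigr => i _; rewrite inE; case: (P i).
Qed.

Lemma odd_nz_mul (h k : E) : h \in Hset -> k \in Hset ->
  odd #|[set i | (h * k) i != 0%R]| =
  odd #|[set i | h i != 0%R]| (+) odd #|[set i | k i != 0%R]|.
Proof.
move=> Hh Hk; rewrite !odd_card_set -big_split /=.
by apply: eq_bigr => i _; exact: Hset_sum.
Qed.

Lemma Kset_group_set : group_set Kset.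
Proof.
apply/group_setP; split=> [|h k].
  rewrite in_Kset (group1 Hgroup) odd_card_set big1 // => i _.
  by rewrite ffunE eqxx.
rewrite !in_Kset => /andP[Hh Oh] /andP[Hk Ok]; rewrite (@groupM _ Hgroup) //=.
by rewrite odd_nz_mul // (negbTE Oh) (negbTE Ok).
Qed.
Canonical Kgroup := Group Kset_group_set.

(* When z is nonzero H / K has order 2 (HmodK), so repr picks the only element *)
(* of (H / K)^#; see iotaHK_inj, iotaHKM and iotaHK_img.                        *)
Definition iotaHK (u : pm1) : coset_of Kgroup :=
  if u == 1 then 1 else repr (Hgroup / Kgroup)^#.

Definition iotaHK_inv (c : coset_of Kgroup) : pm1 :=
  odflt 1 [pick u | iotaHK u == c].

(* The element of E with the same coordinates x_i in {0, ..., s_i - 1}.        *)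
Definition lift_elt (x : G) : E := [ffun i => inZp (x i)].

Definition tau (x : G) : coset_of Kgroup := coset Kgroup (lift_elt x).

Definition fz (x y : G) : pm1 := iotaHK_inv (tau x * tau y * (tau (x * y))^-1).

Definition reduce (g : E) : G := [ffun i => inZp (g i)].

Definition expansion (phi : G -> pm1) (g : E) : pm1 :=
  let a := reduce g in
  if g \in lift_elt a *: Kgroup then phi a else pm1_opp (phi a).

Definition Gamma (psi : cocycle G) (phi : G -> pm1) (w : cext psi) :
    coset_of Kgroup :=
  iotaHK (w.1 * phi w.2) * tau w.2.

Lemma mulEC (g h : E) : g * h = h * g.
Proof.
apply/ffunP => i; rewrite !ffunE /=.
exact: (addrC (g i) (h i)).
Qed.

Lemma in_normK (g : E) : g \in 'N(Kgroup).
Proof.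
apply/normP/setP => h; rewrite mem_conjg conjgE invgK mulEC.
by rewrite mulgKV.
Qed.

Lemma cosetKM (g h : E) :
  coset Kgroup (g * h) = coset Kgroup g * coset Kgroup h.
Proof. by rewrite morphM ?in_normK. Qed.

Lemma cosetKV (g : E) : coset Kgroup g^-1 = (coset Kgroup g)^-1.
Proof. by rewrite morphV ?in_normK. Qed.

Lemma mulcosetC (c d : coset_of Kgroup) : c * d = d * c.
Proof.
by case: (cosetP c) => g _ ->; case: (cosetP d) => h _ ->; rewrite -!cosetKM mulEC.
Qed.

Section Index2.
Hypotheses (s_gt1 : forall i, (1 < s i)%N) (z_nz : exists i, z i).

Lemma HnotK : exists2 e : E, e \in Hset & e \notin Kset.
Proof.
have [i0 zi0] := z_nz.
pose e : E := [ffun j => if j == i0 then (s j)%:R%R else 0%R].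
have eH : e \in Hset.
  by apply/HsetP => j; rewrite ffunE; case: eqP => [->|_]; [right | left].
exists e; rewrite // in_Kset eH /= negbK.
rewrite (_ : [set i | e i != 0%R] = [set i0]) ?cards1 //.
apply/setP => j; rewrite !inE ffunE; case: (eqVneq j i0) => [->|_]; last by rewrite eqxx.
apply/negP => /eqP/(congr1 val)/=; rewrite val_Zp_nat; last first.
  by rewrite zi0 mul2n -addnn (leq_trans (s_gt1 i0)) // leq_addr.
have s0 : (0 < s i0)%N by rewrite ltnW.
by rewrite zi0 modn_small ?(ltn_Pmull) // => s00; rewrite s00 in s0.
Qed.

Lemma HmodK : exists2 e : coset_of Kgroup, e != 1 &
  Hgroup / Kgroup = [set 1; e] :> {set coset_of Kgroup}.
Proof.
have [e eH eK] := HnotK; have eE : e \in 'N(Kgroup) := in_normK e.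
have eO : odd #|[set i | e i != 0%R]| by move: eK; rewrite in_Kset eH negbK.
exists (coset Kgroup e).
  by apply: contra eK => /eqP/coset_idr; apply.
apply/setP => c; rewrite !inE; apply/idP/orP.
  case/morphimP => g _ gH ->.
  have [gO|gO] := boolP (odd #|[set i | g i != 0%R]|); [right | left].
    rewrite -(can_eq (mulgK (coset Kgroup e))) -!cosetKM.
    by rewrite !coset_id // in_Kset (@groupM _ Hgroup) //= odd_nz_mul // ?gO eO.
  by rewrite /= coset_id // in_Kset gH.
by case=> /eqP ->; [exact: group1 | exact: mem_morphim].
Qed.

Lemma iotaHK_inj : injective iotaHK.
Proof.
have [e e1 HE] := HmodK.
have DE : (Hgroup / Kgroup)^# = [set e].
  by rewrite HE; apply/setP => c; rewrite !inE; case: eqP => // ->; rewrite eq_sym (negbTE e1).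
have rE : repr (Hgroup / Kgroup)^# = e by rewrite DE repr_set1.
move=> u v; rewrite /iotaHK rE.
case: (pm1_cases u) => ->; case: (pm1_cases v) => -> //=.
  by move/esym/eqP; rewrite (negbTE e1).
by move/eqP; rewrite (negbTE e1).
Qed.

Lemma iotaHK_img : [set iotaHK u | u : pm1] = Hgroup / Kgroup.
Proof.
have [e e1 HE] := HmodK.
have DE : (Hgroup / Kgroup)^# = [set e].
  by rewrite HE; apply/setP => c; rewrite !inE; case: eqP => // ->; rewrite eq_sym (negbTE e1).
have rE : repr (Hgroup / Kgroup)^# = e by rewrite DE repr_set1.
rewrite HE; apply/setP => c; rewrite !inE; apply/imsetP/orP.
  by case=> u _ ->; rewrite /iotaHK rE; case: ifP; [left | right].
by case=> /eqP ->; [exists 1 | exists (pm1_opp 1)] => //; rewrite /iotaHK.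
Qed.

Lemma iotaHKM : {morph iotaHK : u v / u * v}.
Proof.
have iH u : iotaHK u \in Hgroup / Kgroup by rewrite -iotaHK_img imset_f.
have [e e1 HE] := HmodK.
move=> u v.
have ee : e * e = 1.
  have eH : e \in Hgroup / Kgroup by rewrite HE !inE eqxx orbT.
  have : e * e \in Hgroup / Kgroup by rewrite groupM.
  rewrite HE !inE => /orP[/eqP //|]; rewrite -{3}[e]mulg1 => /eqP/mulgI e1'.
  by rewrite e1' eqxx in e1.
have iN : iotaHK (pm1_opp 1) = e.
  have := iH (pm1_opp 1); rewrite HE !inE => /orP[|/eqP //].
  by move/eqP; rewrite -[1 in RHS]/(iotaHK 1) => /iotaHK_inj.
have i1 : iotaHK 1 = 1 by rewrite /iotaHK eqxx.
case: (pm1_cases u) => ->; first by rewrite mul1g i1 mul1g.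
case: (pm1_cases v) => ->; first by rewrite mulg1 i1 mulg1.
by rewrite pm1_sqr i1 iN ee.
Qed.

Lemma iotaHK_invK (c : coset_of Kgroup) :
  c \in Hgroup / Kgroup -> iotaHK (iotaHK_inv c) = c.
Proof.
rewrite -iotaHK_img => /imsetP[u _ ->]; rewrite /iotaHK_inv.
by case: pickP => [v /eqP // | /(_ u)]; rewrite eqxx.
Qed.

Lemma lift_defect (x y : G) :
  lift_elt x * lift_elt y * (lift_elt (x * y))^-1 \in Hset.
Proof.
apply/HsetP => i; rewrite !ffunE /=.
set m := ((z i + 1) * s i)%N.
set a := nat_of_ord (x i); set b := nat_of_ord (y i).
have sE : (Zp_trunc (s i)).+2 = s i by exact: Zp_cast.
rewrite sE -!Zp_nat.
have la : (a < s i)%N by rewrite -[in ltnRHS]sE ltn_ord.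
have lb : (b < s i)%N by rewrite -[in ltnRHS]sE ltn_ord.
rewrite -[_ * _]/((a%:R + b%:R - ((a + b) %% s i)%:R)%R) -natrD.
rewrite {1 3}(divn_eq (a + b) (s i)) natrD addrK.
have : ((a + b) %/ s i < 2)%N.
  by rewrite ltn_divLR ?(ltnW (s_gt1 i)) // mul2n -addnn -addnS leq_add // ltnW.
case: (_ %/ _)%N => [|[|//]] _; first by left; rewrite mul0n.
rewrite mul1n; case: (boolP (z i)) => zi; [by right | left].
apply/val_inj; rewrite /= val_Zp_nat /m (negbTE zi) ?mul1n ?modnn //.
Qed.

Lemma iotaHK_fz (x y : G) : iotaHK (fz x y) = tau x * tau y * (tau (x * y))^-1.
Proof.
rewrite iotaHK_invK // /tau -cosetKV -!cosetKM.
by rewrite mem_morphim ?in_normK ?lift_defect.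
Qed.

Lemma fz_cocycle : is_cocycle fz.
Proof.
move=> x y t; apply: iotaHK_inj; rewrite !iotaHKM !iotaHK_fz !mulgA.
rewrite mulgKV -[in RHS]mulgA; set c := tau (y * t); set d := (_ (_ * _ * _))^-1.
rewrite -!mulgA (mulcosetC c); congr (_ * _).
by rewrite -!mulgA mulVg mulg1 (mulcosetC d) !mulgA.
Qed.

Definition fz_cobound (phi : G -> pm1) : cocycle G :=
  @Cocycle _ (fun x y => fz x y * cobound phi x y)
    (is_cocycleM fz_cocycle (cobound_cocycle phi)).

End Index2.
End Expansion.

(* Main.v *)
Require Import Defs.
From mathcomp Require Import all_boot all_order all_algebra all_fingroup all_solvable.
Set Implicit Arguments.
Unset Strict Implicit.
Unset Printing Implicit Defensive.
Local Open Scope group_scope.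

(** Coordinatewise reduction modulo s is a homomorphism from E to G with kernel
    H and section x |-> lift_elt x.  Hence g + K = iota(e) + tau(a) with a the
    reduction of g and a unique sign e, which is 1 exactly when g lies in a + K;
    thus phi'(g) = e phi(a), and phi'(g) = 1 says that g + K is
    iota(phi(a)) + tau(a) = Gamma(1, a). *)

Section Reduction.
Variables (r : nat) (s : 'I_r -> nat) (z : 'I_r -> bool).
Hypothesis s_gt1 : forall i, (1 < s i)%N.

Local Notation G := (zprod s).
Local Notation E := (zprodE s z).

Lemma modulusE_gt1 i : (1 < (z i + 1) * s i)%N.
Proof. by rewrite (leq_trans (s_gt1 i)) // addn1 leq_pmull. Qed.

Lemma val_reduce (g : E) i : reduce g i = g i %% s i :> nat.
Proof. by rewrite ffunE /=; congr modn; apply: Zp_cast. Qed.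

Lemma zprod_mulE (m : 'I_r -> nat) (g h : zprod m) i : (1 < m i)%N ->
  (g * h) i = (g i + h i) %% m i :> nat.
Proof. by move=> m1; rewrite ffunE /=; congr modn; apply: Zp_cast. Qed.

(** Each [s i] divides [(z i + 1) * s i], so the wrap-around of addition in [E] is invisible modulo
    [s i]. *)
Lemma reduceM : {morph (@reduce r s z) : g h / g * h}.
Proof.
move=> g h; apply/ffunP => i; apply: val_inj => /=.
rewrite zprod_mulE // !val_reduce zprod_mulE ?modulusE_gt1 //.
by rewrite modn_dvdm ?dvdn_mull // modnDm.
Qed.

Lemma lift_eltK : cancel (@lift_elt r s z) (@reduce r s z).
Proof.
move=> x; apply/ffunP => i; apply: val_inj => /=.
rewrite val_reduce ffunE /= (Zp_cast (modulusE_gt1 i)) modn_dvdm ?dvdn_mull //.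
by rewrite modn_small // -[ltnRHS](Zp_cast (s_gt1 i)) ltn_ord.
Qed.

(** This identifies [H] as the kernel of reduction: a multiple [q * s i] below [(z i + 1) * s i] has
    [q = 0], or [q = 1] and [z i] true. *)
Lemma in_Hset_reduce (h : E) : (h \in Hset s z) = (reduce h == 1).
Proof.
have val_s i : z i -> ((s i)%:R%R : 'Z_((z i + 1) * s i)) = s i :> nat.
  move=> zi; rewrite val_Zp_nat ?modulusE_gt1 // modn_small // zi.
  by rewrite ltn_Pmull // ltnW.
apply/HsetP/eqP => [Hh | h1 i].
  apply/ffunP => i; apply: val_inj; rewrite /= val_reduce ffunE /=.
  by case: (Hh i) => [-> | [zi ->]]; rewrite ?mod0n // val_s // modnn.
have /dvdnP[q hq] : (s i %| h i)%N.
  by rewrite /dvdn -val_reduce h1 ffunE.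
have : (h i < (z i + 1) * s i)%N.
  by rewrite -[ltnRHS](Zp_cast (modulusE_gt1 i)) ltn_ord.
rewrite hq ltn_pmul2r ?(ltnW (s_gt1 i)) //.
case: q hq => [|q] hq; first by left; apply: val_inj.
move=> q_lt; have [zi q0] : z i /\ q = 0%N by move: q_lt; clear; case: (z i) q => [] [].
by right; split=> //; apply: val_inj; rewrite /= hq q0 mul1n val_s.
Qed.

Lemma reduce_defect (g : E) : g * (lift_elt z (reduce g))^-1 \in Hset s z.
Proof.
(* The first factor becomes the reduction of its own lift, so that folding [reduceM] back leaves the
   reduction of a trivial product. *)
rewrite in_Hset_reduce reduceM -[X in X * _](lift_eltK (reduce g)) -reduceM.
by rewrite mulgV -in_Hset_reduce (group1 (Hgroup s z)).
Qed.

End Reduction.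

Section ExpansionCoset.
Variables (r : nat) (s : 'I_r -> nat) (z : 'I_r -> bool).
Hypotheses (s_gt1 : forall i, (1 < s i)%N) (z_nz : exists i, z i).

Lemma iotaHK1 : iotaHK s z 1 = 1.
Proof. by rewrite /iotaHK eqxx. Qed.

Lemma mem_lcosetK (g h : zprodE s z) :
  (g \in h *: Kgroup s z) = (coset (Kgroup s z) g == coset (Kgroup s z) h).
Proof.
rewrite mem_lcoset eq_sym eq_mulVg1 -cosetKV -cosetKM.
apply/idP/eqP => [|/coset_idr]; first exact: coset_id.
by apply; apply: in_normK.
Qed.

Lemma pm1_opp_mulKr (u : pm1) : pm1_opp u * u = pm1_opp 1.
Proof. by case: (pm1_cases u) => ->; apply: val_inj. Qed.

(** By [reduce_defect], the class of [g] is [iotaHK e * tau a] with [a = reduce g]. The expansion at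
    [g] is [e * phi a], and [phi a] squares to 1. *)
Lemma coset_expansion (phi : zprod s -> pm1) (g : zprodE s z) :
  coset (Kgroup s z) g =
  iotaHK s z (expansion phi g * phi (reduce g)) * tau z (reduce g).
Proof.
have /imsetP[e _ eE] :
    coset (Kgroup s z) (g * (lift_elt z (reduce g))^-1) \in [set iotaHK s z u | u : pm1].
  by rewrite iotaHK_img // mem_morphim ?in_normK ?reduce_defect.
have gE : coset (Kgroup s z) g = iotaHK s z e * tau z (reduce g).
  by rewrite -eE /tau -cosetKM mulgKV.
(* Cancelling [tau] and using injectivity of [iotaHK] turns the membership test of [expansion] into
   [e == 1]. *)
rewrite /expansion mem_lcosetK gE -[eqbRHS]mul1g -iotaHK1.
rewrite (can_eq (mulgK _)) (inj_eq (iotaHK_inj s_gt1 z_nz)).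
by case: (pm1_cases e) => ->; rewrite /= ?pm1_sqr ?pm1_opp_mulKr.
Qed.

End ExpansionCoset.

Theorem lemma3 (r : nat) (s : 'I_r -> nat) (s_gt1 : forall i, (1 < s i)%N)
    (z : 'I_r -> bool) (z_nz : exists i, z i)
    (phi : zprod s -> pm1) (phi0 : phi 1 = 1) :
  let psi : cocycle (zprod s) := fz_cobound s_gt1 z_nz phi in
  (fun w : cext psi => Gamma z phi w) @: [set ((1, x) : cext psi) | x : zprod s] =
  [set coset (Kgroup s z) g | g : zprodE s z & expansion phi g == 1].
Proof.
move=> psi; apply/setP => c; apply/imsetP/imsetP.
  case=> _ /imsetP[x _ ->] ->; rewrite /Gamma /= mul1g.
  (* A representative [h] in [H] of [iotaHK (phi x)] shifts the lift of [x] into the class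
     [Gamma (1, x)] without changing its reduction. *)
  have : iotaHK s z (phi x) \in Hgroup s z / Kgroup s z.
    by rewrite -iotaHK_img // imset_f.
  case/morphimP => h _ hH hE.
  have gx : reduce (h * lift_elt z x) = x.
    rewrite reduceM // lift_eltK //.
    by move: hH; rewrite /= in_Hset_reduce // => /eqP->; rewrite mul1g.
  have gE : coset (Kgroup s z) (h * lift_elt z x) = iotaHK s z (phi x) * tau z x.
    by rewrite cosetKM hE.
  exists (h * lift_elt z x); last by rewrite gE.
  have := coset_expansion s_gt1 z_nz phi (h * lift_elt z x).
  (* Two expressions for the same class give [phi x = expansion phi g * phi x] with
     [g = h * lift_elt z x], so the expansion there is 1. *)
  rewrite gE gx => /mulIg/(iotaHK_inj s_gt1 z_nz); rewrite -[LHS]mul1g => /mulIg g1.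
  by rewrite inE -g1.
case=> g; rewrite inE => /eqP g1 ->; exists (1, reduce g); first exact: imset_f.
by rewrite (coset_expansion s_gt1 z_nz phi) g1.
Qed.
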